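(* Let $F:[0,\infty)\to[0,\infty)$ be the slope gap distribution of the square torus with one marked point; equivalently, $F$ is the limiting gap distribution of the Farey fractions. For $R\ge 2$ let $\mathbb{G}_R$ be the collection of renormalized gaps of the slopes of $\Lambda_R$ for the square torus (equivalently, the renormalized gaps of the Farey fractions of denominator $\le R$), and let $N(R)$ be the number of distinct slopes of vectors in $\Lambda_R$. Then there exists a constant $C>0$ such that for all $0\le a<b<\infty$ and all $R\geq 2$, $$\left|\frac{|\mathbb{G}_R\cap(a,b)|}{N(R)}-\int_a^b F(x)\,dx\right|\le C\,\log(R)\,R^{-\frac1{15}}.$$
   Context: The square torus is the unit square with opposite sides identified and one marked point; its set $\Lambda$ of saddle connection (holonomy) vectors is the set of primitive vectors of $\mathbb{Z}^2$. For $R>0$, $\Lambda_R$ is the set of $(x,y)\in\Lambda$ with $x>0$ and $0\le y\le x\le R$. The slopes $y/x$ of vectors in $\Lambda_R$ are exactly the Farey fractions $\{p/q\in[0,1]:\gcd(p,q)=1,\ 0<q\le R\}$. Order the $N(R)$ distinct slopes of $\Lambda_R$ increasingly as $0\le s_R^{(0)}<s_R^{(1)}<\dots<s_R^{(N(R)-1)}\le 1$. The collection of renormalized gaps is $\mathbb{G}_R=\{R^2(s_R^{(i)}-s_R^{(i-1)}):1\le i\le N(R)-1\}$, where gaps are counted with multiplicity, so $|\mathbb{G}_R\cap(a,b)|$ is the number of indices $i$ whose renormalized gap lies in $(a,b)$. The slope gap distribution is the function $F$ such that $\lim_{R\to\infty}|\mathbb{G}_R\cap(a,b)|/N(R)=\int_a^bF(x)\,dx$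 for all $a<b$ (for the square torus it is known to exist and is called Hall's distribution). *)

(* Defs.v *)
From HB Require Import structures.
From mathcomp Require Import all_boot all_order all_algebra finmap.
From mathcomp Require Import all_classical all_reals all_analysis.
Set Implicit Arguments.
Unset Strict Implicit.
Unset Printing Implicit Defensive.
Import Order.TTheory GRing.Theory Num.Theory.
Import numFieldNormedType.Exports.
Local Open Scope classical_set_scope.
Local Open Scope ring_scope.

(* Holonomy vectors of the saddle connections of the square torus with one
   marked point: the primitive vectors of Z^2. *)
Definition Lambda : set (int * int) := [set v | coprimez v.1 v.2].

Definition LambdaR (R : realType) (r : R) : set (int * int) :=
  [set v | [/\ Lambda v, 0 < v.1, 0 <= v.2, v.2 <= v.1 & v.1%:~R <= r]].

Definition slopes (R : realType) (r : R) : set R :=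
  [set v.2%:~R / v.1%:~R | v in LambdaR r].

Lemma finite_LambdaR (R : realType) (r : R) : finite_set (LambdaR r).
Proof.
pose n := `|Num.ceil r|%N.
pose f (p : 'I_n.+1 * 'I_n.+1) : int * int := (Posz p.1, Posz p.2).
apply: (@sub_finite_set _ _ (f @` setT)); last first.
  by apply: finite_image; exact: finite_finset.
move=> [x y] [_ /= x0 y0 yx xr].
have xn : x <= n%:Z.
  have xc : x <= Num.ceil r by rewrite -(ler_int R) (le_trans xr)// ceil_ge.
  by rewrite (le_trans xc)// abszE ler_norm.
case: x x0 yx xr xn => // x x0 yx xr xn.
case: y y0 yx => // y y0 yx.
have xn' : (x < n.+1)%N by rewrite ltnS -lez_nat.
have yn' : (y < n.+1)%N by rewrite (leq_ltn_trans _ xn')// -lez_nat.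
by exists (Ordinal xn', Ordinal yn').
Qed.

(* [fset_set] is meaningful on finite sets only. *)
Lemma finite_slopes (R : realType) (r : R) : finite_set (slopes r).
Proof. exact/finite_image/finite_LambdaR. Qed.

(* The distinct slopes s^(0) < s^(1) < ... *)
Definition slope_seq (R : realType) (r : R) : seq R :=
  sort <=%R (fset_set (slopes r)).

Lemma mem_slope_seq (R : realType) (r x : R) :
  (x \in slope_seq r) <-> slopes r x.
Proof.
by rewrite mem_sort in_fset_set ?inE//; exact: finite_slopes.
Qed.

Lemma slope_seq_sorted (R : realType) (r : R) : sorted <%R (slope_seq r).
Proof.
by rewrite lt_sorted_uniq_le sort_uniq fset_uniq/= sort_le_sorted.
Qed.

Definition num_slopes (R : realType) (r : R) : nat := size (slope_seq r).

(* A list rather than a set: gaps are counted with multiplicity. *)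
Definition renormalized_gaps (R : realType) (r : R) : seq R :=
  [seq r ^+ 2 * ((slope_seq r)`_i - (slope_seq r)`_i.-1)
     | i <- iota 1 (num_slopes r).-1].

Definition gap_proportion (R : realType) (r a b : R) : R :=
  (count (fun g => a < g < b) (renormalized_gaps r))%:R / (num_slopes r)%:R.

(* A density on [0, +oo) is a total function whose values at negative reals are
   irrelevant; the limit hypothesis makes it integrable. *)
Definition slope_gap_distribution (R : realType) (F : R -> R) : Prop :=
  [/\ measurable_fun (`[0, +oo[ : set R) F,
      forall x, 0 <= x -> 0 <= F x &
      forall a b, 0 <= a -> a < b ->
        (gap_proportion r a b)%:E @[r --> +oo]
          --> (\int[lebesgue_measure]_(x in `[a, b]) (F x)%:E)%E].

(* Main.v *)
Require Import Defs.
From HB Require Import structures.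
From mathcomp Require Import all_boot all_order all_algebra finmap zify ring lra.
From mathcomp Require Import all_classical all_reals all_analysis.
Import Order.TTheory GRing.Theory Num.Theory.
Import numFieldNormedType.Exports.
Local Open Scope classical_set_scope.
Local Open Scope ring_scope.

(* Consecutive Farey fractions p/i < p'/j of order Q satisfy p' i - p j = 1, and
   sending a consecutive pair to (i, j) is a bijection onto the coprime pairs
   with 1 <= i, j <= Q < i + j; the renormalized gap is t^2 / (i j).  So one
   counts coprime lattice points in a region dilated by t.  Counting all lattice
   points row by row compares with a Riemann sum of a monotone function, hence
   gives area * t^2 + O(t), uniformly in (a, b).

   Weight the pairs by [gap in (a, b)] - L, with L chosen so that the full
   lattice sum A(t) is O(t).  If C(t) is the sum over coprime pairs, then
   A(t) = sum_(d >= 1) C(t / d), and C(t) = O(t^(29/15)) follows by induction on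
   the integer part of t, without Moebius inversion, because
   sum_(d >= 2) d^(-29/15) < 1.  Dividing by N(t) >= t^2 / 56 shows that the gap
   proportion tends to L at rate t^(-1/15); L is then the integral of F by
   uniqueness of the limit. *)

(** * From all lattice points to coprime ones *)

Lemma big_nat_multiples (V : nmodType) (F : nat -> V) (d n : nat) :
  (0 < d)%N ->
  \sum_(1 <= m < n.+1 | (d %| m)%N) F m =
  \sum_(1 <= m < (n %/ d).+1) F (d * m)%N.
Proof.
move=> d_gt0; elim: n => [|n IHn]; first by rewrite div0n !big_geq.
rewrite big_mkcond big_nat_recr //= -big_mkcond /= IHn divnS //.
case: (boolP (d %| n.+1)%N) => [dn|_]; last by rewrite addr0 add0n.
rewrite add1n [RHS]big_nat_recr //=; congr (_ + F _).
have := divnS n d_gt0; rewrite dn add1n => <-.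
by rewrite mulnC divnK.
Qed.

Definition square_sum {V : nmodType} (w : nat -> nat -> V) (n : nat) : V :=
  \sum_(1 <= i < n.+1) \sum_(1 <= j < n.+1) w i j.

Definition coprime_sum {V : nmodType} (w : nat -> nat -> V) (n : nat) : V :=
  \sum_(1 <= i < n.+1) \sum_(1 <= j < n.+1 | coprime i j) w i j.

(** Sort the pairs by their gcd [d]: those with gcd exactly [d] are [d] times the coprime pairs of
    the square of side [n %/ d]. *)
Lemma square_sum_gcd {V : nmodType} (w : nat -> nat -> V) (n : nat) :
  square_sum w n =
  \sum_(1 <= d < n.+1) coprime_sum (fun i j => w (d * i)%N (d * j)%N) (n %/ d).
Proof.
have -> : square_sum w n = \sum_(1 <= i < n.+1) \sum_(1 <= d < n.+1)
    \sum_(1 <= j < n.+1 | gcdn i j == d) w i j.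
  apply: eq_big_nat => i /andP[i1 iN].
  rewrite (exchange_big_dep_nat xpredT) //=; apply: eq_big_nat => j _.
  rewrite (eq_bigl (fun d => d == gcdn i j)) => [|d]; last by rewrite eq_sym.
  rewrite big_nat1_eq gcdn_gt0 i1 /= ifT //.
  by apply: leq_ltn_trans iN; apply: dvdn_leq => //; exact: dvdn_gcdl.
rewrite exchange_big_nat /=; apply: eq_big_nat => d /andP[d_gt0 _].
pose G i j := if gcdn i j == d then w i j else 0.
(* Rows and columns not divisible by [d] contain no pair of gcd [d], so both indices may be
   restricted to multiples of [d]. *)
transitivity (\sum_(1 <= i < n.+1 | (d %| i)%N)
               \sum_(1 <= j < n.+1 | (d %| j)%N) G i j).
  rewrite [RHS]big_mkcond; apply: eq_bigr => i _.
  have [di|ndi] := boolP (d %| i)%N; last first.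
    by rewrite big1 // => j /eqP dE; rewrite -dE dvdn_gcdl in ndi.
  rewrite big_mkcond [RHS]big_mkcond; apply: eq_bigr => j _; rewrite /G.
  by case: eqP => [<-|_]; rewrite ?dvdn_gcdr ?if_same.
rewrite big_nat_multiples //; apply: eq_bigr => i _.
rewrite big_nat_multiples // [RHS]big_mkcond; apply: eq_bigr => j _.
by rewrite /G -muln_gcdr -{2}[d]muln1 eqn_pmul2l.
Qed.

Section PowerDecay.
Variable R : realType.
Implicit Types (t : R) (w : R -> nat -> nat -> R).

Lemma truncn_div_nat t (d : nat) :
  Num.truncn (t / d%:R) = (Num.truncn t %/ d)%N.
Proof.
case: d => [|d]; first by rewrite invr0 mulr0 truncn0 divn0.
have [t_ge0|t_lt0] := leP 0 t; last first.
  rewrite [in RHS]truncn_floor [in LHS]truncn_floor.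
  by rewrite pmulr_lge0 ?invr_gt0 // leNgt t_lt0 /= div0n.
apply: truncn_def; rewrite ler_pdivlMr // ltr_pdivrMr // -!natrM.
rewrite -truncn_ge_nat // -truncn_lt_nat // leq_trunc_div /=.
by rewrite -ltn_divLR.
Qed.

(** The exponent [1 + u = 29/15] falls short of 2 by [1/15], which is the final rate. *)
Let u : R := 14%:R / 15%:R.

(* Young's inequality gives [(1 - 1/d)^u <= 1 - u/d]. *)
Lemma inv_powR_telescope (d : nat) : (2 <= d)%N ->
  d%:R `^ (- (1 + u)) <=
    u^-1 * (d.-1%:R `^ (- u) - d%:R `^ (- u)).
Proof.
case: d => [|[|d]] // _ /=.
set x : R := d.+1%:R; set y : R := d.+2%:R.
have x0 : 0 < x by rewrite ltr0n.
have y0 : 0 < y by rewrite ltr0n.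
have xy : x = y - 1 by rewrite /x /y -[in RHS]natr1 addrK.
have u0 : 0 < u by rewrite /u; lra.
have px : 0 < x `^ u by rewrite powR_gt0.
have py : 0 < y `^ u by rewrite powR_gt0.
rewrite !powRN powRD; last first.
  by apply/implyP => _; rewrite gt_eqF.
rewrite powRr1 ?(ltW y0) //.
have young : x `^ u <= y `^ u * (1 - u / y).
  have -> : x = y * (x / y) by rewrite mulrCA divff ?mulr1 // gt_eqF.
  have xy0 : 0 <= x / y by rewrite ltW // divr_gt0.
  rewrite powRM ?(ltW y0) // ler_pM2l //.
  (* The conjugate exponents are [1/u = 15/14] and 15, with second factor 1. *)
  have /= := @conjugate_powR R ((x / y) `^ u) 1 u^-1 15%:R.
  rewrite -powRrM mulfV ?gt_eqF // powRr1 ?powR1 ?mulr1 ?invrK //.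
  move=> /(_ (powR_ge0 _ _) ler01); rewrite invr_gt0 => /(_ u0).
  move=> /(_ ltac:(lra)) /(_ ltac:(rewrite /u; lra)) H.
  apply: le_trans H _; rewrite xy mulrBl divff ?gt_eqF //.
  by rewrite /u mul1r; move: y^-1 => z; lra.
set p := x `^ u in px young *; set q := y `^ u in py young *.
have -> : (y * q)^-1 = u^-1 * (u / y) * q^-1 by field; rewrite !gt_eqF.
rewrite -mulrA ler_pM2l ?invr_gt0 //.
(* This follows from [young] and [(1 - z) * (1 + z) <= 1] with [z = u / y]. *)
have : p * (1 + u / y) <= q.
  have uy : 0 < u / y by rewrite divr_gt0.
  apply: (@le_trans _ _ (q * ((1 - u / y) * (1 + u / y)))).
    by rewrite mulrA ler_pM2r // ltr_wpDr // ltW.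
  by rewrite -[leRHS]mulr1 ler_pM2l // -subr_sqr expr1n lerBlDr ler_wpDr // sqr_ge0.
move=> H; rewrite lerBrDr -[X in _ + X]mul1r -mulrDl ler_pdivrMr //.
by rewrite [leRHS]mulrC ler_pdivlMr // mulrC addrC.
Qed.

(** The term [d = 2] is kept and the later ones telescope, which gives [(1/2 + 15/14) * 2^(-u)].
    With [2^(-u) <= 8/15] this is [88/105 < 6/7]. *)
Lemma sum_inv_powR_le (n : nat) :
  \sum_(2 <= d < n.+1) d%:R `^ (- (1 + u)) <= 6%:R / 7%:R :> R.
Proof.
have u0 : 0 < u by rewrite /u; lra.
suff H m : \sum_(2 <= d < m.+3) d%:R `^ (- (1 + u)) + u^-1 * m.+2%:R `^ (- u)
    <= (2^-1 + u^-1) * 2%:R `^ (- u) :> R.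
  have two : 2%:R `^ (- u) <= 8%:R / 15%:R :> R.
    (* Young's inequality gives [2^(1/15) <= 2/15 + 14/15 = 16/15], which is then halved. *)
    have -> : - u = -1 + 15%:R^-1 by rewrite /u; lra.
    rewrite powRD ?pnatr_eq0 ?implybT // powR_inv1 //.
    have := @conjugate_powR R (2%:R `^ 15%:R^-1) 1 15%:R u^-1 (powR_ge0 _ _) ler01.
    rewrite -powRrM mulVf ?pnatr_eq0 // powRr1 // powR1 mulr1 invrK invr_gt0.
    move=> /(_ ltac:(lra) u0 ltac:(rewrite /u; lra)).
    by rewrite /u; move: (2%:R `^ _) => z; lra.
  case: n => [|[|n]]; [by rewrite big_geq //; lra| by rewrite big_geq //; lra|].
  have := H n; have : 0 <= u^-1 * n.+2%:R `^ (- u).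
    by rewrite mulr_ge0 ?powR_ge0 // invr_ge0 ltW.
  move: two; move: (_ * n.+2%:R `^ _) (\sum_(_ <= _ < _) _) (2 `^ _) => a b c.
  by rewrite /u invfM invrK; lra.
elim: m => [|m IHm].
  rewrite big_nat1 mulrDl lerD2r opprD powRD ?pnatr_eq0 ?implybT //.
  by rewrite powR_inv1.
apply: le_trans IHm; rewrite big_nat_recr //= -addrA lerD2l.
have := @inv_powR_telescope m.+3 isT; rewrite mulrBr /=; lra.
Qed.

(** In [square_sum_gcd] the term [d = 1] is the wanted sum; by homogeneity each term [d >= 2] is the
    same sum at scale [t / d], to which the induction hypothesis applies. *)
Lemma coprime_sum_bound w (c : R) :
  (forall t d i j, (0 < d)%N -> w t (d * i)%N (d * j)%N = w (t / d%:R) i j) ->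
  (forall t, 1 <= t -> `|square_sum (w t) (Num.truncn t)| <= c * t) ->
  forall t, 1 <= t ->
    `|coprime_sum (w t) (Num.truncn t)| <= 7%:R * c * t `^ (1 + u).
Proof.
move=> hom bnd t; have [n] := ubnP (Num.truncn t).
elim: n t => // n IHn t; rewrite ltnS => tn t1.
have t0 : 0 < t by apply: lt_le_trans t1.
have u0 : 0 < u by rewrite /u; lra.
have c0 : 0 <= c.
  by have := le_trans (normr_ge0 _) (bnd _ t1); rewrite pmulr_lge0.
have Q0 : (0 < Num.truncn t)%N by rewrite truncn_gt0.
have /esym := square_sum_gcd (w t) (Num.truncn t).
rewrite big_ltn ?ltnS // divn1.
rewrite (_ : coprime_sum (fun i j => _) _ = coprime_sum (w t) (Num.truncn t));
  last first.
  by apply: eq_bigr => i _; apply: eq_bigr => j _; rewrite !mul1n.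
move=> /eqP; rewrite eq_sym -subr_eq => /eqP <-.
apply: le_trans (ler_normB _ _) _.
(* The constant 7 solves [K = 1 + K * (6/7)]. *)
apply: (@le_trans _ _ (c * t `^ (1 + u) +
  7%:R * c * t `^ (1 + u) * (6%:R / 7%:R))); last by lra.
apply: lerD.
  apply: le_trans (bnd _ t1) _; rewrite ler_wpM2l //.
  by rewrite le1r_powR // lerDl ltW.
apply: (@le_trans _ _ (7%:R * c * t `^ (1 + u) *
    \sum_(2 <= d < (Num.truncn t).+1) d%:R `^ (- (1 + u)))); last first.
  by rewrite ler_wpM2l ?sum_inv_powR_le // !mulr_ge0 ?powR_ge0.
apply: le_trans (ler_norm_sum _ _ _) _; rewrite mulr_sumr.
rewrite big_nat [leRHS]big_nat; apply: ler_sum => d /andP[d2 dQ].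
have d0 : (0 < d)%N by apply: leq_trans d2.
have d0R : 0 < d%:R :> R by rewrite ltr0n.
rewrite (_ : coprime_sum _ _ = coprime_sum (w (t / d%:R)) (Num.truncn (t / d%:R))).
  apply: le_trans (IHn _ _ _) _.
  - by rewrite truncn_div_nat; apply: leq_trans tn; rewrite ltn_Pdiv.
  - by rewrite ler_pdivlMr // mul1r -truncn_ge_nat ?ltW.
  - by rewrite powRM ?invr_ge0 ?(ltW t0) ?(ltW d0R) // mulrA -powR_inv1
      ?(ltW d0R) // -powRrM mulN1r.
rewrite truncn_div_nat; apply: eq_bigr => i _; apply: eq_bigr => j _.
exact: hom.
Qed.

End PowerDecay.

(** * Lattice points in the dilated region *)

Section LatticePoints.
Variable R : realType.
Implicit Types (f : R -> R) (x y t c : R) (P : nat -> bool).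

Local Notation mu := (@lebesgue_measure R).

Lemma nonincreasing_integrable {f} x y :
  {homo f : a b /~ b <= a} -> mu.-integrable `[x, y] (EFin \o f).
Proof.
move=> fi; apply: measurable_bounded_integrable => //.
- rewrite /= lebesgue_measure_itv /=.
  by case: ifP => _; rewrite ?ltry // -EFinB ltry.
- exact: measurable_realfun.nonincreasing_measurable.
- exists (`|f x| + `|f y|); split; first exact: num_real.
  move=> M ltM z /=; rewrite in_itv /= => /andP[xz zy].
  apply: le_trans (ltW ltM); rewrite ler_norml.
  have := fi _ _ xz; have := fi _ _ zy.
  have := ler_norm (f x); have := normr_ge0 (f y).
  have := ler_norm (- f y); have := normr_ge0 (f x); rewrite normrN.
  by lra.
Qed.

Lemma nonincreasing_Rintegral_bounds f x y :
  {homo f : a b /~ b <= a} -> 0 <= x -> x <= y ->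
  (y - x) * f y <= \int[mu]_(z in `[0, y]) f z - \int[mu]_(z in `[0, x]) f z
                <= (y - x) * f x.
Proof.
move=> fi x0 xy; rewrite Rintegral_itvB ?bnd_simp //; last exact: nonincreasing_integrable.
have intxy h : {homo h : a b /~ b <= a} -> mu.-integrable `]x, y] (EFin \o h).
  move=> hi; apply: (integrableS _ _ _ (nonincreasing_integrable x y hi)) => //.
  by apply: subset_itvr; rewrite bnd_simp.
have cst (k : R) : \int[mu]_(_ in `]x, y]) k = (y - x) * k.
  rewrite Rintegral_cst //= lebesgue_measure_itv /= lte_fin mulrC.
  move: xy; rewrite le_eqVlt => /predU1P[->|->] //=.
  by rewrite ltxx /= subrr.
have cst_nonincr (k : R) : {homo (fun=> k) : a b /~ b <= a} by [].
rewrite -2!cst; apply/andP; split.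
  apply: le_Rintegral => //; [exact: intxy|exact: intxy|move=> z /=].
  by rewrite in_itv /= => /andP[_ zy]; exact: fi.
apply: le_Rintegral => //; [exact: intxy|exact: intxy|move=> z /=].
by rewrite in_itv /= => /andP[/ltW xz _]; exact: fi.
Qed.

(** [I] is the integral of [f] over [[0, 1]]. Monotonicity costs at most [f 0 <= 1] over the full
    cells of width [1/t], and the incomplete last cell costs at most 1 more. *)
Lemma nonincreasing_riemann_sum f :
  {homo f : a b /~ b <= a} -> f 0 <= 1 -> 0 <= f 1 ->
  exists2 I : R, 0 <= I <= 1 & forall t, 1 <= t ->
    `|\sum_(1 <= m < (Num.truncn t).+1) f (m%:R / t) - t * I| <= 2%:R.
Proof.
move=> fi f0 f1; pose G y := \int[mu]_(z in `[0, y]) f z.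
have Gb x y : 0 <= x -> x <= y -> (y - x) * f y <= G y - G x <= (y - x) * f x.
  exact: nonincreasing_Rintegral_bounds.
have G0 : G 0 = 0.
  by rewrite /G set_itv1 Rintegral_set1.
exists (G 1).
  have := Gb 0 1 (lexx _) ler01; rewrite G0; lra.
move=> t t1; have t0 : 0 < t by apply: lt_le_trans t1.
set Q := Num.truncn t.
have Qt : Q%:R <= t by rewrite truncn_le ltW.
have tQ : t < Q%:R + 1 by rewrite natr1 truncnS_gt.
have H k : \sum_(1 <= m < k.+1) f (m%:R / t) <= t * G (k%:R / t) <=
    \sum_(1 <= m < k.+1) f (m%:R / t) + f 0 - f (k%:R / t).
  elim: k => [|k IHk]; first by rewrite big_geq // mul0r G0; lra.
  rewrite big_nat_recr //=.
  have k0 : 0 <= k%:R / t by rewrite divr_ge0 // ltW.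
  have kk : k%:R / t <= k.+1%:R / t by rewrite ler_pM2r ?invr_gt0 // ler_nat.
  have := Gb _ _ k0 kk.
  have -> : k.+1%:R / t - k%:R / t = t^-1 by rewrite -mulrBl -natr1 addrC addKr mul1r.
  rewrite ler_pdivrMl // ler_pdivlMl // mulrBr.
  move: IHk; move: (\sum_(_ <= _ < _) _) (t * _) (t * _) (f _) (f _) => a b e g h.
  lra.
have qt : Q%:R / t <= 1 by rewrite ler_pdivrMr // mul1r.
have q0 : 0 <= Q%:R / t by rewrite divr_ge0 // ltW.
have /andP[b1 b2] := H Q.
have /andP[c1 c2] := Gb _ _ q0 qt.
have fq : 0 <= f (Q%:R / t) <= 1.
  by rewrite (le_trans f1 (fi _ _ qt)) (le_trans (fi _ _ q0) f0).
have e1 : t * (1 - Q%:R / t) <= 1.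
  by rewrite mulrBr mulr1 mulrCA divff ?gt_eqF // mulr1; lra.
have e0 : 0 <= 1 - Q%:R / t by rewrite subr_ge0.
have d1 : 0 <= t * (G 1 - G (Q%:R / t)).
  by rewrite mulr_ge0 ?(ltW t0) // (le_trans _ c1) // mulr_ge0.
have d2 : t * (G 1 - G (Q%:R / t)) <= 1.
  rewrite (le_trans _ e1) // ler_pM2l // (le_trans c2) // ler_piMr //; lra.
rewrite mulrBr in d1 d2; move: d1 d2 b1 b2 fq f0; rewrite ler_norml.
move: (\sum_(_ <= _ < _) _) (t * G 1) (t * G _) (f _) (f _) => p q r s v; lra.
Qed.

(** [P] may hold or fail at [j = y], so strict and non-strict inequalities are covered together. *)
Lemma count_threshold P (y : R) (n : nat) :
  (forall j, (0 < j <= n)%N -> j%:R < y -> P j) ->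
  (forall j, (0 < j <= n)%N -> P j -> j%:R <= y) ->
  0 <= y -> y <= n%:R + 1 ->
  `|\sum_(1 <= j < n.+1) (P j)%:R - y| <= 1.
Proof.
move=> Plt Ple y0 yn; set S := \sum_(_ <= _ < _) _.
(* The bounds by [n] make the induction on [n] go through. *)
suff : S <= n%:R /\ S <= y /\ (n%:R <= S \/ y - 1 <= S).
  by move=> [Sn [Sy [nS|yS]]]; rewrite ler_norml; lra.
rewrite {}/S {yn}.
elim: n Plt Ple => [|n IHn] Plt Ple; first by rewrite big_geq //; lra.
rewrite big_nat_recr //=.
have : (forall j, (0 < j <= n)%N -> j%:R < y -> P j) by
  move=> j /andP[j0 jn]; apply: Plt; rewrite j0 leqW.
have : (forall j, (0 < j <= n)%N -> P j -> j%:R <= y) by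
  move=> j /andP[j0 jn]; apply: Ple; rewrite j0 leqW.
move=> Ple' Plt'; have {IHn} [] := IHn Plt' Ple'.
move: (\sum_(_ <= _ < _) _) => S S1 [S2 S3].
have := Plt n.+1; have := Ple n.+1; rewrite ltnSn -natr1 => /(_ isT) H1 /(_ isT) H2.
have [H3|H3] := ltP (n%:R + 1) y.
  have nS : n%:R <= S by case: S3 => ?; lra.
  by rewrite H2 //=; split; [lra|split; [lra|left; lra]].
have yS : y - 1 <= S by case: S3 => ?; lra.
case: (P n.+1) H1 => [/(_ isT) H1|_] /=.
  by split; [lra|split; [lra|right; lra]].
by rewrite addr0; split; [lra|split; [lra|right; lra]].
Qed.

(* For [x = i / t], [t * row_length c x] is the largest [y] such that every
   [0 < j < y] satisfies [j <= t] and ([c * i * j < t^2] or [i + j <= t]). *)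
Definition row_length c x : R := Num.max (Num.max 1 (c * x))^-1 (1 - x).

Lemma row_length_nonincreasing {c} : 0 <= c ->
  {homo row_length c : a b /~ b <= a}.
Proof.
move=> c0 b a ba; rewrite /row_length ge_max !le_max; apply/andP; split.
  apply/orP; left; rewrite lef_pV2 ?posrE ?lt_max ?ltr01 //.
  by rewrite ge_max !le_max lexx /= ler_wpM2l ?orbT.
by apply/orP; right; rewrite lerB.
Qed.

Lemma row_length0 c : row_length c 0 = 1.
Proof. by rewrite /row_length mulr0 subr0 (max_l ler01) invr1 maxxx. Qed.

Lemma row_length1_ge0 c : 0 <= row_length c 1.
Proof. by rewrite /row_length subrr le_max lexx orbT. Qed.

Lemma row_count c t (i : nat) P : 0 <= c -> 1 <= t ->
  (0 < i <= Num.truncn t)%N ->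
  (forall j, (c * (i * j)%:R < t ^+ 2) || ((i + j)%:R <= t) -> P j) ->
  (forall j, P j -> (c * (i * j)%:R <= t ^+ 2) || ((i + j)%:R <= t)) ->
  `|\sum_(1 <= j < (Num.truncn t).+1) (P j)%:R - t * row_length c (i%:R / t)|
    <= 1.
Proof.
move=> c0 t1 /andP[i0 iQ] Plt Ple.
have t0 : 0 < t by apply: lt_le_trans t1.
have x0 : 0 <= i%:R / t by rewrite divr_ge0 // ltW.
have x1 : i%:R / t <= 1.
  by rewrite ler_pdivrMr // mul1r -truncn_ge_nat // ltW.
have tQ : t < (Num.truncn t)%:R + 1 by rewrite natr1 truncnS_gt.
have M0 : 0 < Num.max 1 (c * (i%:R / t)) by rewrite lt_max ltr01.
have tx : t * (1 - i%:R / t) = t - i%:R.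
  by rewrite mulrBr mulr1 mulrCA divff ?gt_eqF // mulr1.
have cE j : j%:R * (c * (i%:R / t)) = c * (i * j)%:R / t.
  by rewrite natrM; ring.
apply: count_threshold => [j jQ|j /andP[_ jQ] Pj||].
- rewrite /row_length maxr_pMr ?(ltW t0) // tx lt_max => jy; apply: Plt.
  case/orP: jy => [|jy]; last by apply/orP; right; rewrite natrD; lra.
  rewrite ltr_pdivlMr // => jy; apply/orP; left.
  rewrite expr2 -ltr_pdivrMr // -cE; apply: le_lt_trans jy.
  by rewrite ler_wpM2l // le_max lexx orbT.
- rewrite /row_length maxr_pMr ?(ltW t0) // tx le_max.
  case/orP: (Ple _ Pj) => [cj|ij]; last by apply/orP; right; move: ij; rewrite natrD; lra.
  apply/orP; left; rewrite ler_pdivlMr // maxr_pMr // ge_max mulr1 cE.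
  by rewrite -truncn_ge_nat ?(ltW t0) // jQ /= ler_pdivrMr // -expr2.
- rewrite mulr_ge0 ?(ltW t0) // (le_trans (row_length1_ge0 c)) //.
  exact: (row_length_nonincreasing c0 _ _ x1).
- apply: le_trans (ltW tQ); rewrite -[leRHS]mulr1 ler_pM2l // -[leRHS](row_length0 c).
  exact: (row_length_nonincreasing c0 _ _ x0).
Qed.


Lemma sum_row_length {c} : 0 <= c ->
  exists2 I : R, 0 <= I <= 1 & forall t, 1 <= t ->
    `|\sum_(1 <= i < (Num.truncn t).+1) row_length c (i%:R / t) - t * I|
      <= 2%:R.
Proof.
move=> c0; apply: nonincreasing_riemann_sum.
- exact: row_length_nonincreasing.
- by rewrite row_length0.
- exact: row_length1_ge0.
Qed.

(* For [i], [j] positive: [a < t^2 / (i j) < b]. *)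
Definition gap_in (a b t : R) (i j : nat) : bool :=
  a * (i * j)%:R < t ^+ 2 < b * (i * j)%:R.

(** The first factor selects denominators of neighbouring fractions; subtracting [L] centres the
    indicator of the gap condition. *)
Definition farey_weight (a b L t : R) (i j : nat) : R :=
  (t < (i + j)%:R)%R%:R * ((gap_in a b t i j)%:R - L).

(** Both conditions are homogeneous: [i + j] scales like [t], and [i * j] like [t ^+ 2]. This is the
    scaling hypothesis of [coprime_sum_bound]. *)
Lemma farey_weight_scale a b L t (d i j : nat) : (0 < d)%N ->
  farey_weight a b L t (d * i)%N (d * j)%N = farey_weight a b L (t / d%:R) i j.
Proof.
move=> d0; have dR : 0 < d%:R :> R by rewrite ltr0n.
have scale_sq (k : R) : k * (d * i * (d * j))%:R = k * (i * j)%:R * d%:R ^+ 2.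
  by rewrite mulnACA mulnn [in LHS]natrM natrX; ring.
rewrite /farey_weight /gap_in -mulnDr [(d * _)%:R]natrM [d%:R * _]mulrC.
rewrite -ltr_pdivrMr // !scale_sq expr_div_n.
congr (_ * (_%:R - L)).
by rewrite ltr_pdivlMr ?exprn_gt0 // ltr_pdivrMr ?exprn_gt0.
Qed.

(** Row [i] has exactly [i] entries with [i + j > Q], so the sum is a triangular number. *)
Lemma sum_over_diagonal t : 1 <= t ->
  square_sum (fun i j => (t < (i + j)%:R)%R%:R : R) (Num.truncn t) =
  (Num.truncn t)%:R * ((Num.truncn t)%:R + 1) / 2%:R.
Proof.
move=> t1; have t0 : 0 <= t by rewrite (le_trans ler01).
set Q := Num.truncn t.
have tE k : (t < k%:R) = (Q < k)%N by rewrite truncn_lt_nat.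
transitivity (\sum_(1 <= i < Q.+1) i%:R : R).
  apply: eq_big_nat => i /andP[i0 iQ].
  rewrite (@big_cat_nat _ _ _ (Q - i).+1) //= ?ltnS ?leq_subr //.
  rewrite big_nat big1 ?add0r => [|j /andP[_ jQ]]; last first.
    by rewrite tE (_ : (Q < _)%N = false) //; lia.
  rewrite big_nat (eq_bigr (fun=> 1)) => [|j /andP[jQ _]]; last first.
    by rewrite tE (_ : (Q < _)%N = true) //; lia.
  by rewrite -big_nat sumr_const_nat subSS subKn.
elim: Q {tE} => [|Q IHQ]; first by rewrite big_geq // mul0r mul0r.
by rewrite big_nat_recr //= IHQ -natr1; field.
Qed.

Lemma square_sum_gap_in a b : 0 <= a -> a < b ->
  exists2 L : R, `|L| <= 2%:R & forall t, 1 <= t ->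
    `|square_sum (farey_weight a b L t) (Num.truncn t)| <= 8%:R * t.
Proof.
move=> a0 ab; have b0 : 0 <= b by rewrite ltW // (le_lt_trans a0).
have [Ia Ia01 HIa] := sum_row_length a0; have [Ib Ib01 HIb] := sum_row_length b0.
(* After division by [t], the gap condition cuts out area [Ia - Ib] in the triangle [x + y > 1] of
   the unit square, whose area is [1/2]; [L] is the quotient. *)
exists (2%:R * (Ia - Ib)); first by rewrite ler_norml; lra.
move=> t t1; have t0 : 0 < t by apply: lt_le_trans t1.
set Q := Num.truncn t; set L := 2%:R * _.
have Qt : Q%:R <= t by rewrite truncn_le ltW.
have tQ : t < Q%:R + 1 by rewrite natr1 truncnS_gt.
(* Adjoining the region [i + j <= t] to both counts makes each row an initial
   segment of the integers; its contribution cancels in the difference. *)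
pose Pa i j := (a * (i * j)%:R < t ^+ 2) || ((i + j)%:R <= t).
pose Pb i j := (b * (i * j)%:R <= t ^+ 2) || ((i + j)%:R <= t).
have split_weight i j : (0 < i * j)%N -> farey_weight a b L t i j =
    (Pa i j)%:R - (Pb i j)%:R - L * (t < (i + j)%:R)%R%:R.
  move=> ij; rewrite /farey_weight /Pa /Pb /gap_in.
  have abij : a * (i * j)%:R < b * (i * j)%:R by rewrite ltr_pM2r // ltr0n.
  case: (ltP t (i + j)%:R) => _; rewrite ?orbF ?orbT.
    case: (ltP (a * _) (t ^+ 2)) => H1 /=; last first.
      by rewrite leNgt (le_lt_trans H1 abij) /=; lra.
    by case: ltP => H2 /=; lra.
  by rewrite /=; lra.
(* Each summand is an error term; the main terms [t ^+ 2 * (Ia - Ib)] and [L * t ^+ 2 / 2] cancel by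
   the choice of [L]. *)
have -> : square_sum (farey_weight a b L t) Q =
  \sum_(1 <= i < Q.+1) (\sum_(1 <= j < Q.+1) (Pa i j)%:R
     - t * row_length a (i%:R / t))
  - \sum_(1 <= i < Q.+1) (\sum_(1 <= j < Q.+1) (Pb i j)%:R
     - t * row_length b (i%:R / t))
  + t * (\sum_(1 <= i < Q.+1) row_length a (i%:R / t) - t * Ia)
  - t * (\sum_(1 <= i < Q.+1) row_length b (i%:R / t) - t * Ib)
  + L * (t ^+ 2 / 2%:R -
    square_sum (fun i j => (t < (i + j)%:R)%R%:R : R) Q).
  rewrite !sumrB -!mulr_sumr.
  transitivity (\sum_(1 <= i < Q.+1) \sum_(1 <= j < Q.+1) (Pa i j)%:R
    - \sum_(1 <= i < Q.+1) \sum_(1 <= j < Q.+1) (Pb i j)%:R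
    - L * square_sum (fun i j => (t < (i + j)%:R)%R%:R : R) Q).
    rewrite /square_sum mulr_sumr -!sumrB big_nat [RHS]big_nat.
    apply: eq_bigr => i /andP[i0 _]; rewrite mulr_sumr -!sumrB.
    rewrite big_nat [RHS]big_nat; apply: eq_bigr => j /andP[j0 _].
    by rewrite split_weight ?muln_gt0 ?i0.
  by rewrite /L; field.
have bound_rows (P : nat -> nat -> bool) (c : R) : 0 <= c ->
    (forall i j, (c * (i * j)%:R < t ^+ 2) || ((i + j)%:R <= t) -> P i j) ->
    (forall i j, P i j -> (c * (i * j)%:R <= t ^+ 2) || ((i + j)%:R <= t)) ->
    `|\sum_(1 <= i < Q.+1) (\sum_(1 <= j < Q.+1) (P i j)%:R
     - t * row_length c (i%:R / t))| <= t.
  move=> c0 P1 P2; apply: le_trans Qt; apply: le_trans (ler_norm_sum _ _ _) _.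
  have -> : Q%:R = \sum_(1 <= i < Q.+1) 1 :> R by rewrite sumr_const_nat subSS subn0.
  rewrite big_nat [leRHS]big_nat; apply: ler_sum => i iQ.
  by apply: row_count => // j; [exact: P1|exact: P2].
have ra : `|\sum_(1 <= i < Q.+1) (\sum_(1 <= j < Q.+1) (Pa i j)%:R
     - t * row_length a (i%:R / t))| <= t.
  apply: bound_rows => // i j; rewrite /Pa => /orP[/ltW ->|->] //; exact: orbT.
have rb : `|\sum_(1 <= i < Q.+1) (\sum_(1 <= j < Q.+1) (Pb i j)%:R
     - t * row_length b (i%:R / t))| <= t.
  apply: bound_rows => // i j; rewrite /Pb => /orP[/ltW ->|->] //; exact: orbT.
have := HIa _ t1; have := HIb _ t1.
rewrite sum_over_diagonal // -/Q.
move: ra rb.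
move: (\sum_(_ <= i < _) (_ - t * row_length a _)).
move=> A; move: (\sum_(_ <= i < _) (_ - t * row_length b _)) => B.
move: (_ - t * Ia) (_ - t * Ib) => C D HA HB HD HC.
have {HD} : `|t * D| <= 2%:R * t by rewrite normrM gtr0_norm // mulrC ler_pM2r.
have {HC} : `|t * C| <= 2%:R * t by rewrite normrM gtr0_norm // mulrC ler_pM2r.
have diag : `|t ^+ 2 / 2%:R - Q%:R * (Q%:R + 1) / 2%:R| <= t / 2%:R.
  have Q0 : 0 <= Q%:R :> R by [].
  rewrite ler_norml; nra.
have : `|L * (t ^+ 2 / 2%:R - Q%:R * (Q%:R + 1) / 2%:R)| <= t.
  apply: (@le_trans _ _ (2%:R * (t / 2%:R))); last by lra.
  rewrite normrM; apply: ler_pM => //.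
  by rewrite ler_norml /L; lra.
(* The errors add up to [7 * t]: [2 * t] from the rows, [4 * t] from the Riemann sums, [t] from the
   diagonal. *)
move: HA HB; rewrite !ler_norml.
move: (t * C) (t * D) (L * _) => c d e; lra.
Qed.

End LatticePoints.

(** * Farey neighbours *)

Lemma bezout_coprime (m n u v : nat) :
  (u * m = v * n + 1)%N -> coprime v m && coprime u n.
Proof.
have aux g : (g %| u * m -> g %| v * n -> u * m = v * n + 1 -> g == 1)%N.
  by move=> gu gv e; move: gu; rewrite e dvdn_addr // dvdn1.
move=> e; apply/andP; split; apply: aux e.
- by rewrite dvdn_mull // dvdn_gcdr.
- by rewrite dvdn_mulr // dvdn_gcdl.
- by rewrite dvdn_mulr // dvdn_gcdl.
- by rewrite dvdn_mull // dvdn_gcdr.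
Qed.

Lemma eq_of_modn_window (m n i q : nat) :
  (m = n %[mod i])%N -> (m <= q < m + i)%N -> (n <= q < n + i)%N -> m = n.
Proof.
wlog mn : m n / (m <= n)%N.
  move=> wl; case/orP: (leq_total m n) => h e hm hn; first exact: wl.
  by apply/esym/wl.
move=> /eqP; rewrite eq_sym eqn_mod_dvd // => /dvdnP[k kE] hm hn.
by case: k kE => [|k]; nia.
Qed.

Lemma modn_mulIl (k m n i : nat) : coprime k i ->
  (k * m = k * n %[mod i])%N -> (m = n %[mod i])%N.
Proof.
wlog mn : m n / (n <= m)%N.
  move=> wl; case/orP: (leq_total m n) => h ki e; last exact: wl.
  by apply/esym/wl.
move=> ki /eqP; rewrite eqn_mod_dvd ?leq_mul // -mulnBr => d.
by apply/eqP; rewrite eqn_mod_dvd // -(@Gauss_dvdr _ k) // coprime_sym.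
Qed.

Section Farey.
Variable R : realType.
Implicit Types (r x : R).

Lemma ltr_frac (p q h k : nat) : (0 < q)%N -> (0 < k)%N ->
  (p%:R / q%:R < h%:R / k%:R :> R) = (p * k < h * q)%N.
Proof.
move=> q0 k0; rewrite ltr_pdivrMr ?ltr0n // mulrAC ltr_pdivlMr ?ltr0n //.
by rewrite -!natrM ltr_nat.
Qed.

Lemma reduced_frac_inj (p q h k : nat) : (0 < q)%N -> (0 < k)%N ->
  coprime p q -> coprime h k -> p%:R / q%:R = h%:R / k%:R :> R ->
  p = h /\ q = k.
Proof.
move=> q0 k0 pq hk /eqP; rewrite eqr_div ?pnatr_eq0 -?lt0n //.
rewrite -!natrM eqr_nat => /eqP e.
have qk : q = k.
  apply/eqP; rewrite eqn_dvd; apply/andP; split.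
    by rewrite -(@Gauss_dvdr _ p) 1?coprime_sym // e dvdn_mull.
  by rewrite -(@Gauss_dvdr _ h) 1?coprime_sym // -e dvdn_mull.
by split=> //; apply/eqP; rewrite -(eqn_pmul2r k0) e qk.
Qed.

(** Unimodularity gives [k = q * (p' * k - h * q') + q' * (h * q - p * k)], and both brackets are
    positive integers. *)
Lemma between_unimodular (p q p' q' h k : nat) :
  (0 < q)%N -> (0 < q')%N -> (0 < k)%N -> (p' * q = p * q' + 1)%N ->
  p%:R / q%:R < h%:R / k%:R :> R -> h%:R / k%:R < p'%:R / q'%:R :> R ->
  (q + q' <= k)%N.
Proof. by move=> q0 q'0 k0 e; rewrite !ltr_frac //; nia. Qed.

Lemma slopesP r x : 1 <= r ->
  slopes r x <-> exists p q : nat,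
    [/\ (0 < q <= Num.truncn r)%N, (p <= q)%N, coprime p q & x = p%:R / q%:R].
Proof.
move=> r1; have r0 : 0 <= r by rewrite (le_trans ler01).
split.
  case=> -[[q|q] [p|p]] [] //= cqp q0 _ pq qr <-; exists p, q.
  rewrite truncn_ge_nat //; split => //.
  - by apply/andP; split.
  - by rewrite coprime_sym.
case=> p [q [/andP[q0 qr] pq cpq ->]]; exists (Posz q, Posz p) => //.
split => //=; first by rewrite /Lambda /= /coprimez /= coprime_sym in cpq *.
by rewrite -truncn_ge_nat.
Qed.

(* [egcdn i j] returns [(p', p)] with [p' * i = p * j + 1] and [p < i] when [i]
   and [j] are coprime. *)
Definition farey_left (ij : nat * nat) : R := (egcdn ij.1 ij.2).2%:R / ij.1%:R.
Definition farey_right (ij : nat * nat) : R := (egcdn ij.1 ij.2).1%:R / ij.2%:R.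

Definition farey_pairs (n : nat) : seq (nat * nat) :=
  [seq ij <- [seq (i, j) | i <- index_iota 1 n.+1, j <- index_iota 1 n.+1]
     | coprime ij.1 ij.2 & (n < ij.1 + ij.2)%N].

Lemma mem_farey_pairs (n i j : nat) : ((i, j) \in farey_pairs n) =
  [&& coprime i j, (n < i + j)%N, (0 < i <= n)%N & (0 < j <= n)%N].
Proof.
rewrite mem_filter /= -andbA; congr [&& _, _ & _].
apply/allpairsP/andP => [[[a b] /= [+ + [-> ->]]]|[hi hj]].
  by rewrite !mem_index_iota.
by exists (i, j); rewrite !mem_index_iota.
Qed.

Lemma farey_pairs_uniq (n : nat) : uniq (farey_pairs n).
Proof.
apply: filter_uniq; apply: allpairs_uniq; rewrite ?iota_uniq //.
by move=> [] ? ? [] ? ? _ _ /= [-> ->].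
Qed.

Lemma big_farey_pairs (V : nmodType) (F : nat -> nat -> V) (n : nat) :
  \sum_(ij <- farey_pairs n) F ij.1 ij.2 =
  coprime_sum (fun i j => if (n < i + j)%N then F i j else 0) n.
Proof.
rewrite big_filter big_mkcond big_allpairs; apply: eq_bigr => i _.
rewrite [RHS]big_mkcond; apply: eq_bigr => j _ /=.
by case: coprime; case: ltnP.
Qed.

(** The Bezout relation puts both fractions in lowest terms, and [p < i] forces [p' <= j], so both
    lie in [[0, 1]]. *)
Lemma farey_pairP (n i j : nat) :
  (i, j) \in farey_pairs n -> exists p p' : nat,
  [/\ (p' * i = p * j + 1)%N /\ (p < i)%N, (p' <= j)%N,
    coprime p i /\ coprime p' j,
    farey_left (i, j) = p%:R / i%:R & farey_right (i, j) = p'%:R / j%:R].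
Proof.
rewrite mem_farey_pairs => /and4P[cij _ /andP[i0 _] /andP[j0 _]].
rewrite /farey_left /farey_right /=.
case: (egcdnP j i0) => p' p; rewrite (eqP cij) muln1 => e pi /=.
have /andP[c1 c2] := bezout_coprime _ _ _ _ e.
by exists p, p'; split=> //; nia.
Qed.

Lemma farey_right_sub_left (n i j : nat) : (i, j) \in farey_pairs n ->
  farey_right (i, j) - farey_left (i, j) = (i * j)%:R^-1.
Proof.
move=> ijB; have [p [p' [[e _] _ _ -> ->]]] := farey_pairP _ _ _ ijB.
move: ijB; rewrite mem_farey_pairs => /and4P[_ _ /andP[i0 _] /andP[j0 _]].
have := congr1 (fun k => k%:R : R) e; rewrite /= natrD !natrM => eR.
have iR : i%:R != 0 :> R by rewrite pnatr_eq0 -lt0n.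
have jR : j%:R != 0 :> R by rewrite pnatr_eq0 -lt0n.
apply: (@mulIf _ (i%:R * j%:R)); first by rewrite mulf_neq0.
rewrite mulVf ?mulf_neq0 // mulrBl.
have -> : p'%:R / j%:R * (i%:R * j%:R) = p'%:R * i%:R :> R by field.
by rewrite eR; field.
Qed.

(* [farey_left] determines [i] and the residue of [j] modulo [i], and [j] lies in
   the window [n - i < j <= n]. *)
Lemma farey_left_inj (n : nat) : {in farey_pairs n &, injective farey_left}.
Proof.
move=> [i j] [i' j'] ijB ijB'.
have [p [p' [[e _] _ [cpi _] -> _]]] := farey_pairP _ _ _ ijB.
have [h [h' [[e' _] _ [chi _] -> _]]] := farey_pairP _ _ _ ijB'.
move: ijB ijB'; rewrite !mem_farey_pairs.
move=> /and4P[_ nij /andP[i0 _] /andP[j0 jn]].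
move=> /and4P[_ nij' /andP[i0' _] /andP[j0' jn']] eqf.
have [ph ii'] := reduced_frac_inj _ _ _ _ i0 i0' cpi chi eqf.
rewrite -{}ii' -{}ph {i0' eqf chi} in e' nij' *; congr (_, _).
apply: (eq_of_modn_window _ _ i n); rewrite ?jn ?jn' ?[(_ + i)%N]addnC //.
apply: (modn_mulIl p) => //; apply/eqP; rewrite -(eqn_modDr 1) -e -e'.
by rewrite !modnMl.
Qed.

Lemma farey_left_onto (n p q : nat) : (0 < q <= n)%N -> (p < q)%N ->
  coprime p q ->
  exists2 ij, ij \in farey_pairs n & farey_left ij = p%:R / q%:R.
Proof.
move=> /andP[q0 qn] pq cpq.
case: (egcdnP p q0) => u y; rewrite gcdnC (eqP cpq) muln1 => e yq.
(* The largest integer up to [n] congruent to [y] modulo [q], so that [n < q + j]. *)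
pose j := (y + q * ((n - y) %/ q))%N.
have yn : (y <= n)%N by apply: leq_trans qn; apply: ltnW.
have jn : (j <= n < q + j)%N.
  have := divn_eq (n - y) q; have := ltn_pmod (n - y) q0; rewrite /j; nia.
have ej : ((u + p * ((n - y) %/ q)) * q = p * j + 1)%N by rewrite /j; nia.
have cqj : coprime q j.
  by move: ej; rewrite [(p * j)%N]mulnC => /bezout_coprime; rewrite coprime_sym => /andP[].
have jB : (q, j) \in farey_pairs n.
  by rewrite mem_farey_pairs cqj q0 qn; lia.
exists (q, j) => //.
have [h [h' [[e' hq] _ [chq _] -> _]]] := farey_pairP _ _ _ jB.
congr (_%:R / _).
(* Both numerators are below [q] and solve [j * z + 1 = 0] modulo [q], where [j] is invertible. *)
suff : (h = p %[mod q])%N by rewrite !modn_small.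
apply: (modn_mulIl j); first by rewrite coprime_sym.
apply/eqP; rewrite ![(j * _)%N]mulnC -(eqn_modDr 1) -ej -e'.
by rewrite !modnMl.
Qed.

Lemma slope_seq_nth_lt r (k l : nat) :
  (k < size (slope_seq r))%N -> (l < size (slope_seq r))%N ->
  ((slope_seq r)`_k < (slope_seq r)`_l) = (k < l)%N.
Proof. by move=> ks ls; apply: lt_sorted_ltn_nth; rewrite ?slope_seq_sorted. Qed.

Lemma slope_seq_uniq r : uniq (slope_seq r).
Proof. by rewrite sort_uniq fset_uniq. Qed.

(** A slope strictly between the two fractions would have denominator at least [i + j], which
    exceeds [Num.truncn r]. *)
Lemma farey_consecutive r (ij : nat * nat) : 1 <= r ->
  ij \in farey_pairs (Num.truncn r) ->
  exists k, [/\ (k.+1 < size (slope_seq r))%N,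
    (slope_seq r)`_k = farey_left ij & (slope_seq r)`_k.+1 = farey_right ij].
Proof.
case: ij => i j r1 ijB; set s := slope_seq r.
have [p [p' [[e pi] pj [cpi cpj] lE rE]]] := farey_pairP _ _ _ ijB.
move: (ijB); rewrite mem_farey_pairs => /and4P[_ nij i0n j0n].
have /andP[i0 _] := i0n; have /andP[j0 _] := j0n.
have ls : farey_left (i, j) \in s.
  apply/mem_slope_seq/slopesP => //; exists p, i; split=> //; exact: ltnW.
have rs : farey_right (i, j) \in s.
  by apply/mem_slope_seq/slopesP => //; exists p', j.
pose k := index (farey_left (i, j)) s; pose l := index (farey_right (i, j)) s.
have ks : (k < size s)%N by rewrite index_mem.
have lsz : (l < size s)%N by rewrite index_mem.
have sk : s`_k = farey_left (i, j) by rewrite nth_index.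
have sl : s`_l = farey_right (i, j) by rewrite nth_index.
have kl : (k < l)%N.
  by rewrite -(slope_seq_nth_lt r) // -/s sk sl lE rE ltr_frac // e; lia.
have k1s : (k.+1 < size s)%N by apply: leq_ltn_trans lsz.
exists k; split=> //; rewrite -sl.
case: (ltngtP k.+1 l) (kl) => // [kl1 _|->//].
have /mem_slope_seq/(slopesP _ _ r1)[h [q [/andP[q0 qr] _ _ hqE]]] := mem_nth 0 k1s.
have : (i + j <= q)%N.
  apply: (between_unimodular _ _ _ _ h q i0 j0 q0 e); rewrite -hqE -/s.
    by rewrite -lE -sk slope_seq_nth_lt.
  by rewrite -rE -sl slope_seq_nth_lt.
by move=> /(leq_trans nij); rewrite ltnNge qr.
Qed.

(** The last slope is left out because it is the left end of no gap. *)
Lemma farey_left_perm r : 1 <= r ->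
  perm_eq [seq farey_left ij | ij <- farey_pairs (Num.truncn r)]
    (take (num_slopes r).-1 (slope_seq r)).
Proof.
move=> r1; apply: uniq_perm.
- by rewrite map_inj_in_uniq ?farey_pairs_uniq //; exact: farey_left_inj.
- exact/take_uniq/slope_seq_uniq.
move=> x; apply/mapP/idP => [[ij ijB ->]|xs].
  have [k [ks <- _]] := farey_consecutive _ _ r1 ijB.
  have sz := ltn_predK ks.
  have kn : (k < (num_slopes r).-1)%N by rewrite -ltnS /num_slopes sz.
  rewrite -(nth_take 0 kn) mem_nth // size_take -/(num_slopes r).
  by case: ifP => // _; apply: ltnW.
have xS := mem_take xs; move: (xs); rewrite in_take // => xk.
have k1 : ((index x (slope_seq r)).+1 < size (slope_seq r))%N.
  by move: xk; rewrite /num_slopes; lia.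
move: (mem_nth 0 k1) (xS); move=> /mem_slope_seq/(slopesP _ _ r1)[h [l [/andP[l0 _] hl _ hlE]]].
move=> /mem_slope_seq/(slopesP _ _ r1)[p [q [q0n pq cpq xE]]].
have /andP[q0 qn] := q0n.
(* Having a successor [h / l <= 1], the slope [x] is below 1, as [farey_left_onto] requires. *)
have : x < h%:R / l%:R.
  by rewrite -hlE -[X in X < _](nth_index 0 xS) slope_seq_nth_lt ?index_mem.
rewrite xE ltr_frac // => lt_ph.
have pq' : (p < q)%N by nia.
by have [ij ijB <-] := farey_left_onto _ _ _ q0n pq' cpq; exists ij.
Qed.

Lemma big_renormalized_gaps (V : nmodType) (phi : R -> V) r : 1 <= r ->
  \sum_(g <- renormalized_gaps r) phi g =
  coprime_sum (fun i j => if (Num.truncn r < i + j)%N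
    then phi (r ^+ 2 / (i * j)%:R) else 0) (Num.truncn r).
Proof.
move=> r1; set s := slope_seq r; set n := (num_slopes r).-1.
rewrite -(big_farey_pairs _ (fun i j => phi (r ^+ 2 / (i * j)%:R))).
(* Each gap is written as a function of its left end, so that the permutation of left ends can
   reindex the sum. *)
pose gap x := r ^+ 2 * (s`_(index x s).+1 - x).
have -> : renormalized_gaps r = [seq gap x | x <- take n s].
  rewrite /renormalized_gaps -/n -/s -(@map_nth_iota0 _ 0); last exact: leq_pred.
  rewrite -map_comp -[1%N]addn0 iotaDl -map_comp; apply/eq_in_map => k.
  rewrite mem_iota add0n => /andP[_ kn] /=.
  by rewrite /gap index_uniq ?slope_seq_uniq // (leq_trans kn) // leq_pred.
rewrite big_map -(perm_big _ (farey_left_perm r r1)) /= big_map.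
rewrite big_seq [RHS]big_seq; apply: eq_bigr => -[i j] ijB; congr phi.
have [k [ks kl kr]] := farey_consecutive _ _ r1 ijB.
rewrite /gap -kl index_uniq ?slope_seq_uniq ?(ltnW ks) // -/s kl kr.
by rewrite (farey_right_sub_left _ _ _ ijB).
Qed.

Lemma num_slopesE r : 1 <= r -> num_slopes r =
  (coprime_sum (fun i j => (Num.truncn r < i + j)%N : nat) (Num.truncn r)).+1.
Proof.
move=> r1; have := big_renormalized_gaps _ (fun=> 1%N) _ r1.
rewrite sum1_size size_map size_iota => e.
(* There are [(num_slopes r).-1] gaps, and the truncated predecessor is undone only for a nonempty
   list; the slope 0 provides this. *)
have : (0 < num_slopes r)%N.
  rewrite lt0n; apply/negP => /nilP s0.
  have : (0 : R) \in slope_seq r.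
    apply/mem_slope_seq/slopesP => //; exists 0%N, 1%N.
    by rewrite truncn_gt0 r1 mul0r.
  by rewrite s0.
by move=> /prednK <-; rewrite e.
Qed.

(** Coprime pairs with [i <= j] inject into the slopes through [i / j], and the remaining ones do so
    after a swap. *)
Lemma coprime_pairs_le_num_slopes r : 1 <= r ->
  (coprime_sum (fun i j => 1%N : nat) (Num.truncn r) <= (num_slopes r).*2)%N.
Proof.
move=> r1; set n := Num.truncn r.
pose below := coprime_sum (fun i j => (i <= j)%N : nat) n.
have below_le : (below <= num_slopes r)%N.
  pose D := [seq ij <- [seq (i, j) | i <- index_iota 1 n.+1, j <- index_iota 1 n.+1]
     | coprime ij.1 ij.2 & (ij.1 <= ij.2)%N].
  have -> : below = size D.
    rewrite -sum1_size big_filter big_mkcond big_allpairs; apply: eq_bigr => i _.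
    rewrite [LHS]big_mkcond; apply: eq_bigr => j _ /=.
    by case: coprime; case: leqP.
  have inD i j : (i, j) \in D ->
      [/\ (0 < i)%N, (0 < j <= n)%N, coprime i j & (i <= j)%N].
    rewrite mem_filter /= => /andP[/andP[cij lij]] /allpairsP[[a b] /= [+ + [ia jb]]].
    by rewrite !mem_index_iota -ia -jb => /andP[i0 _] j0.
  rewrite -(size_map (fun ij => ij.1%:R / ij.2%:R : R)); apply: uniq_leq_size.
    rewrite map_inj_in_uniq; last first.
      move=> [i j] [i' j'] /inD[i0 /andP[j0 _] cij _] /inD[i0' /andP[j0' _] cij' _].
      by move=> /(reduced_frac_inj _ _ _ _ j0 j0' cij cij')[-> ->].
    apply: filter_uniq; apply: allpairs_uniq; rewrite ?iota_uniq //.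
    by move=> [] ? ? [] ? ? _ _ /= [-> ->].
  move=> x /mapP[[i j] /inD[i0 j0n cij lij] ->].
  by apply/mem_slope_seq/slopesP => //; exists i, j.
rewrite -addnn; apply: leq_trans (leq_add below_le below_le).
(* Exchanging the sums turns the second copy into the pairs with [j <= i]; the diagonal is counted
   twice, which is harmless. *)
rewrite {2}/below {2}/coprime_sum.
under [X in (_ <= _ + X)%N]eq_bigr do rewrite big_mkcond.
rewrite exchange_big_nat /=.
rewrite /below /coprime_sum -big_split /=; apply: leq_sum => i _.
rewrite -big_mkcond /= big_mkcond [X in (_ <= X + _)%N]big_mkcond.
rewrite [X in (_ <= _ + X)%N]big_mkcond -big_split /=; apply: leq_sum => j _.
by rewrite [coprime j i]coprime_sym; case: coprime => //; case: (leqP i j) => [|/ltnW h]; rewrite ?h.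
Qed.

End Farey.

(** * Rate of convergence *)

Section Estimate.
Variable R : realType.
Implicit Types (a b r L : R).

(** For weight 1, [square_sum_gcd] splits [n ^+ 2]; the terms [d >= 2] are at most [n^2 / d^2] and
    together take at most [6/7] of it. *)
Lemma coprime_pairs_ge (n : nat) :
  n%:R ^+ 2 / 7%:R <= (coprime_sum (fun i j => 1%N : nat) n)%:R :> R.
Proof.
case: n => [|n]; first by rewrite expr0n mul0r.
set m := n.+1.
have sqE k : square_sum (fun i j => 1%N : nat) k = (k * k)%N.
  by rewrite /square_sum !sum_nat_const_nat !subSS !subn0 muln1.
have cop_le k : (coprime_sum (fun i j => 1%N : nat) k <= k * k)%N.
  rewrite -sqE; apply: leq_sum => i _; rewrite big_mkcond.
  by apply: leq_sum => j _; case: ifP.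
have := square_sum_gcd (fun i j => 1%N : nat) m.
rewrite sqE big_ltn // divn1 => /(congr1 (GRing.natmul (1 : R))).
rewrite natrD natrM -expr2 [X in _ + X]natr_sum => e.
have : \sum_(2 <= d < m.+1) (coprime_sum (fun i j => 1%N : nat) (m %/ d))%:R
    <= m%:R ^+ 2 * (6%:R / 7%:R) :> R.
  apply: le_trans (ler_wpM2l (sqr_ge0 _) (sum_inv_powR_le R m)).
  rewrite mulr_sumr big_nat [leRHS]big_nat; apply: ler_sum => d /andP[d2 _].
  have d0 : (0 : R) < d%:R by rewrite ltr0n ltnW.
  have d1 : (1 : R) <= d%:R by rewrite ler1n ltnW.
  apply: (@le_trans _ _ ((m %/ d) * (m %/ d))%:R); first by rewrite ler_nat.
  apply: (@le_trans _ _ (m%:R ^+ 2 * d%:R ^- 2)).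
    rewrite natrM -expr2 -expr_div_n lerXn2r ?nnegrE ?divr_ge0 //.
    by rewrite ler_pdivlMr // -natrM ler_nat leq_trunc_div.
  rewrite ler_wpM2l ?sqr_ge0 // powRN lef_pV2 ?posrE ?exprn_gt0 ?powR_gt0 //.
  rewrite -powR_mulrn ?(ltW d0) // ler_powR //.
  by clear; lra.
by move: e; move: (\sum_(2 <= _ < _) _) => S; lra.
Qed.

(** Here [56 = 7 * 2 * 4]: density [1/7], two pairs per slope, and [Num.truncn r >= r / 2]. *)
Lemma num_slopes_ge r : 1 <= r -> r ^+ 2 / 56%:R <= (num_slopes r)%:R.
Proof.
move=> r1; have := coprime_pairs_le_num_slopes R r r1.
rewrite -(ler_nat R) -mul2n natrM => h.
have := le_trans (coprime_pairs_ge _) h.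
have rQ : r < (Num.truncn r)%:R + 1 by rewrite natr1 truncnS_gt.
have Q1 : 1 <= (Num.truncn r)%:R :> R by rewrite ler1n truncn_gt0.
move: (Num.truncn r)%:R (num_slopes r)%:R rQ Q1 => q N rq q1.
by nra.
Qed.

Lemma count_renormalized_gaps a b r : 1 <= r ->
  (count (fun g => a < g < b) (renormalized_gaps r))%:R =
  coprime_sum (fun i j => (r < (i + j)%:R)%R%:R * (gap_in R a b r i j)%:R)
    (Num.truncn r) :> R.
Proof.
move=> r1; have r0 : 0 <= r by rewrite (le_trans ler01).
transitivity (\sum_(g <- renormalized_gaps r) (a < g < b)%R%:R : R).
  by rewrite -sum1_count big_mkcond natr_sum.
rewrite (big_renormalized_gaps R R (fun g => (a < g < b)%R%:R)) //.
rewrite /coprime_sum big_nat [RHS]big_nat; apply: eq_bigr => i /andP[i0 _].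
rewrite big_nat_cond [RHS]big_nat_cond.
apply: eq_bigr => j /andP[/andP[j0 _] _].
rewrite -truncn_lt_nat //; case: (_ < _)%N; last by rewrite mul0r.
have ij : 0 < (i * j)%:R :> R by rewrite ltr0n muln_gt0 i0.
by rewrite mul1r /gap_in ltr_pdivlMr // ltr_pdivrMr.
Qed.

Lemma gap_proportion_rate a b : 0 <= a -> a < b ->
  exists L, forall r, 1 <= r ->
    `|gap_proportion r a b - L| <= 58%:R * 56%:R * r `^ (- 15%:R^-1).
Proof.
move=> a0 ab; have [L L2 HL] := square_sum_gap_in R a b a0 ab.
exists L => r r1; have r0 : 0 < r by apply: lt_le_trans r1.
have := coprime_sum_bound R (farey_weight R a b L) 8%:R _ HL r r1.
move=> /(_ (fun t d i j => farey_weight_scale R a b L t d i j)).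
set C := coprime_sum _ _ => HC.
(* There is one gap fewer than slopes, whence the extra [L] in the numerator below. *)
have CE : C = (count (fun g => a < g < b) (renormalized_gaps r))%:R
    - L * ((num_slopes r)%:R - 1).
  rewrite count_renormalized_gaps // num_slopesE // -natr1 addrK natr_sum.
  rewrite mulr_sumr -sumrB; apply: eq_bigr => i _.
  rewrite natr_sum mulr_sumr -sumrB; apply: eq_bigr => j _.
  by rewrite /farey_weight mulrBr mulrC [L * _]mulrC -truncn_lt_nat // ltW.
have N0 := num_slopes_ge r r1.
have Npos : 0 < (num_slopes r)%:R :> R.
  by apply: lt_le_trans N0; rewrite divr_gt0 // exprn_gt0.
set N := (num_slopes r)%:R in CE N0 Npos.
rewrite /gap_proportion -/N.
have -> : (count (fun g => a < g < b) (renormalized_gaps r))%:R / N - L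
    = (C - L) / N by rewrite CE; field; rewrite gt_eqF.
rewrite normrM normfV (gtr0_norm Npos) ler_pdivrMr //.
have pow : r `^ (1 + 14%:R / 15%:R) = r `^ (- 15%:R^-1) * r ^+ 2.
  rewrite -powR_mulrn ?(ltW r0) // -powRD; last by rewrite (gt_eqF r0) implybT.
  by congr (_ `^ _); lra.
have p1 : 1 <= r `^ (- 15%:R^-1) * r ^+ 2.
  by rewrite -pow -[leLHS](powRr0 r) ler_powR //; lra.
(* [58 = 7 * 8 + 2]: the bound on [C] plus [|L| <= 2]. *)
apply: (@le_trans _ _ (58%:R * (r `^ (- 15%:R^-1) * r ^+ 2))).
  rewrite pow in HC; apply: le_trans (ler_normB _ _) _.
  by move: HC L2 p1; move: (_ * r ^+ 2) `|C| `|L| => x y z; clear; lra.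
have -> : 58%:R * (r `^ (- 15%:R^-1) * r ^+ 2)
    = (58%:R * 56%:R) * r `^ (- 15%:R^-1) * (r ^+ 2 / 56%:R).
  by move: (r `^ _) => x; field.
by rewrite ler_wpM2l ?mulr_ge0 ?powR_ge0.
Qed.

Lemma cvg_powR_rate (f : R -> R) (L K s : R) : 0 < s ->
  (forall r, 1 <= r -> `|f r - L| <= K * r `^ (- s)) ->
  f r @[r --> +oo] --> L.
Proof.
move=> s0 H; apply/cvgrPdist_le => e e0.
pose K' := Num.max 1 K.
have K'0 : 0 < K' by rewrite lt_max ltr01.
near=> r.
have r1 : 1 <= r by near: r; apply: nbhs_pinfty_ge; rewrite num_real.
have r0 : 0 < r by apply: lt_le_trans r1.
rewrite distrC; apply: le_trans (H r r1) _.
apply: (@le_trans _ _ (K' * r `^ (- s))).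
  by rewrite ler_wpM2r ?powR_ge0 // le_max lexx orbT.
rewrite powRN ler_pdivrMr ?powR_gt0 // -ler_pdivrMl //.
(* Past this threshold [r^s >= K' / e], which is the required inequality. *)
have big : (e^-1 * K') `^ s^-1 <= r.
  by near: r; apply: nbhs_pinfty_ge; rewrite num_real.
have := ge0_ler_powR (ltW s0) _ _ big.
rewrite -powRrM mulVf ?gt_eqF // powRr1; last by rewrite mulr_ge0 // ltW ?invr_gt0.
by apply; rewrite nnegrE ?powR_ge0 ?ltW.
Unshelve. all: by end_near.
Qed.

End Estimate.

Theorem theorem1p1 (R : realType) (F : R -> R)
    (hF : slope_gap_distribution F) :
  exists2 C : R, 0 < C &
    forall a b r : R, 0 <= a -> a < b -> 2 <= r ->
      (`| (gap_proportion r a b)%:E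
          - \int[lebesgue_measure]_(x in `[a, b]) (F x)%:E |
       <= (C * ln r * r `^ (- (15%:R)^-1))%:E)%E.
Proof.
case: hF => _ _ hlim.
have ln2 : 0 < ln 2%:R :> R by rewrite ln_gt0 // ltr1n.
(* Dividing by [ln 2] makes room for the factor [ln r], since [r >= 2]. *)
exists (58%:R * 56%:R / ln 2%:R); first by rewrite divr_gt0 ?mulr_gt0.
move=> a b r a0 ab r2.
have r1 : 1 <= r by lra.
have [L HL] := gap_proportion_rate R a b a0 ab.
have s0 : 0 < 15%:R^-1 :> R by rewrite invr_gt0.
have limL : (gap_proportion r a b)%:E @[r --> +oo] --> L%:E.
  by apply: cvg_EFin; [exact: nearW|exact: cvg_powR_rate s0 HL].
(* The gap proportion converges both to the integral, by hypothesis, and to [L], by the rate. *)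
have -> : (\int[lebesgue_measure]_(x in `[a, b]) (F x)%:E)%E = L%:E.
  exact: (cvg_unique (@ereal_hausdorff R) (hlim a b a0 ab) limL).
rewrite -EFinB abse_EFin lee_fin; apply: le_trans (HL r r1) _.
rewrite ler_wpM2r ?powR_ge0 // mulrAC ler_pdivlMr // ler_pM2l //.
by rewrite ler_ln // posrE; lra.
Qed.
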